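(* Let $m,n$ be positive integers. If $\min\{m,n\}=1$, then $w_{c}(K_{m,n})=W_{c}(K_{m,n})=m+n-1$. If $\min\{m,n\}\geq 2$, then $\left[\max\{m,n\},m+n\right]\subseteq F\left(K_{m,n}\right)$.
   Context: $K_{m,n}$ is the complete bipartite graph with parts of sizes $m$ and $n$. For a finite simple graph $G$ and a positive integer $t$, an interval cyclic $t$-coloring of $G$ is a proper edge-coloring of $G$ with colors $1,\ldots,t$ such that all $t$ colors are used and, for each vertex $v$, the edges incident to $v$ are colored by $d_{G}(v)$ consecutive colors modulo $t$ (i.e. consecutive in the cyclic order $1,2,\ldots,t,1$), where $d_G(v)$ is the degree of $v$. The feasible set $F(G)$ is the set of all $t$ such that $G$ has an interval cyclic $t$-coloring; when $F(G)\neq\emptyset$, $w_{c}(G)$ and $W_{c}(G)$ are the least and the greatest elements of $F(G)$. $[a,b]$ denotes the set of integers $\{a,\ldots,b\}$. *)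

(* Defs.v *)
From HB Require Import structures.
From mathcomp Require Import all_boot.

Set Implicit Arguments.
Unset Strict Implicit.
Unset Printing Implicit Defensive.

Record sgraph := SGraph {
  vertex :> finType;
  adj : rel vertex;
  adj_sym : symmetric adj;
  adj_irr : irreflexive adj
}.

Definition edges (G : sgraph) : {set {set G}} :=
  [set [set p.1; p.2] | p : G * G & adj p.1 p.2].

Definition degree (G : sgraph) (v : G) : nat := #|[set u : G | adj v u]|.

Definition proper_edge_coloring (G : sgraph) (t : nat) (c : {set G} -> nat) : Prop :=
  (forall e, e \in edges G -> 1 <= c e <= t) /\
  (forall e f v, e \in edges G -> f \in edges G -> v \in e -> v \in f ->
     c e = c f -> e = f).

(* A coloring [c] is a total function on sets of vertices; its values outside
   [edges G] are irrelevant.  In the last clause, the colors at [v] are exactly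
   the representatives in {1, ..., t} of the residues of
   s, s + 1, ..., s + degree v - 1. *)
Definition interval_cyclic_coloring (G : sgraph) (t : nat) (c : {set G} -> nat) : Prop :=
  [/\ proper_edge_coloring t c,
      forall k, 1 <= k <= t -> exists2 e, e \in edges G & c e = k
    & forall v : G, exists s : nat, forall k, 1 <= k <= t ->
        (exists2 e, e \in edges G & v \in e /\ c e = k) <->
        (exists2 i, i < degree v & k = s + i %[mod t])].

(* [F G t] means that t belongs to the feasible set of G. *)
Definition F (G : sgraph) (t : nat) : Prop :=
  0 < t /\ exists c : {set G} -> nat, interval_cyclic_coloring t c.

(* w_c(G) and W_c(G) exist only when the feasible set is nonempty, so they are
   given by their graphs: [is_wc G k] and [is_Wc G k] state that w_c(G),
   respectively W_c(G), exists and equals k. *)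
Definition is_wc (G : sgraph) (k : nat) : Prop :=
  F G k /\ forall t, F G t -> k <= t.

Definition is_Wc (G : sgraph) (k : nat) : Prop :=
  F G k /\ forall t, F G t -> t <= k.

Definition Kadj (m n : nat) : rel ('I_m + 'I_n)%type := fun x y =>
  match x, y with
  | inl _, inr _ | inr _, inl _ => true
  | _, _ => false
  end.

Lemma Kadj_sym m n : symmetric (@Kadj m n).
Proof. by move=> [x|x] [y|y]. Qed.

Lemma Kadj_irr m n : irreflexive (@Kadj m n).
Proof. by move=> [x|x]. Qed.

Definition K (m n : nat) : sgraph := SGraph (@Kadj_sym m n) (@Kadj_irr m n).

(* Main.v *)
Require Import Defs.
From mathcomp Require Import all_boot zify.

(** An edge-coloring of [K m n] is an m by n matrix of colors: the rows and
    columns list the colors at the two kinds of vertices.  Numbering rows,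
    columns and colors from 0, with colors taken modulo t, it is an interval
    cyclic t-coloring once every residue occurs in the matrix and every row
    (column) meets each of n (m) consecutive residues, where
    max(m, n) <= t ([F_K_of_matrix]); properness and the absence of other
    residues follow by counting ([interval_mod_inj], [interval_mod_surj]).

    For max(m, n) <= t <= m + n - 1 the matrix with entries i + j has this
    property ([F_K_le]).  For t = m + n it only misses the residue
    m + n - 1; this is repaired by adding n to every entry of column 0 but the first.  A row
    i, ..., i + n - 1 with i > 0 then becomes the interval i + 1, ..., i + n,
    and column 0 becomes 0, n + 1, ..., n + m - 1, which is the interval
    n + 1, ..., n + m modulo m + n ([F_K_add]).

    In a star all edges share the center, so an interval cyclic t-coloring is
    a bijection from the neighbors of the center to the colors, and t is the
    degree of the center ([F_star_degree]). *)

Set Implicit Arguments.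
Unset Strict Implicit.
Unset Printing Implicit Defensive.

(** A family of d values meeting d <= t consecutive residues modulo t meets
    each of them exactly once, and meets nothing else. *)
Section IntervalMod.

Variables (d t s : nat) (h : 'I_d -> nat).
Hypothesis le_dt : d <= t.
Hypothesis hP : forall l, l < d -> exists j, h j = s + l %[mod t].

Lemma interval_mod_bij :
  exists2 g : 'I_d -> 'I_d, injective g &
    forall l : 'I_d, h (g l) = s + l %[mod t].
Proof.
have hP' (l : 'I_d) : exists j, h j %% t == (s + l) %% t.
  by have [j hj] := hP (ltn_ord l); exists j; apply/eqP.
exists (fun l => xchoose (hP' l)) => [l1 l2 eq_l|l]; last first.
  exact/eqP/(xchooseP (hP' l)).
have := eqP (xchooseP (hP' l1)); rewrite eq_l (eqP (xchooseP (hP' l2))).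
move/eqP; rewrite eqn_modDl !modn_small ?(leq_trans (ltn_ord _)) //.
by move=> /eqP/val_inj.
Qed.

Lemma interval_mod_surj (j : 'I_d) : exists2 l, l < d & h j = s + l %[mod t].
Proof.
have [g /injF_bij [g' _ gK] hg] := interval_mod_bij.
by exists (g' j); rewrite // -hg gK.
Qed.

Lemma interval_mod_inj (j1 j2 : 'I_d) : h j1 = h j2 %[mod t] -> j1 = j2.
Proof.
have [g /injF_bij [g' _ gK] hg] := interval_mod_bij.
rewrite -(gK j1) -(gK j2) !hg => /eqP.
rewrite eqn_modDl !modn_small ?(leq_trans (ltn_ord _)) //.
by move=> /eqP/val_inj ->.
Qed.

End IntervalMod.

Section CompleteBipartite.

Variables m n : nat.

(** The edge joining vertex i of the first part to vertex j of the second. *)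
Definition Kedge (i : 'I_m) (j : 'I_n) : {set K m n} := [set inl i; inr j].

Lemma Kedge_inj i j i' j' : Kedge i j = Kedge i' j' -> i = i' /\ j = j'.
Proof.
move=> /setP eqE; have := eqE (inl i); have := eqE (inr j).
rewrite !inE !eqxx orbT /= => /esym/eqP[->] /esym.
by rewrite orbF => /eqP[->].
Qed.

Lemma mem_Kedgel i' i j : ((inl i' : K m n) \in Kedge i j) = (i' == i).
Proof. by rewrite !inE orbF. Qed.

Lemma mem_Kedger j' i j : ((inr j' : K m n) \in Kedge i j) = (j' == j).
Proof. by rewrite !inE. Qed.

Lemma Kedge_in i j : Kedge i j \in edges (K m n).
Proof. by apply/imsetP; exists (inl i, inr j); rewrite ?inE. Qed.

Lemma edges_KP e : e \in edges (K m n) -> exists i j, e = Kedge i j.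
Proof.
case/imsetP=> [[[x|x] [y|y]]] //; rewrite inE //= => _ ->.
  by exists x, y.
by exists y, x; rewrite /Kedge setUC.
Qed.

Lemma degree_Kl (i : 'I_m) : degree (inl i : K m n) = n.
Proof.
rewrite -[RHS]card_ord /degree -cardsT.
have inr_inj : injective (inr : 'I_n -> K m n) by move=> j1 j2 [].
rewrite -(card_imset _ inr_inj); apply: eq_card => -[x|x]; rewrite inE /=.
  by apply/esym/negP => /imsetP[].
by apply/esym/imsetP; exists x; rewrite ?inE.
Qed.

Lemma degree_Kr (j : 'I_n) : degree (inr j : K m n) = m.
Proof.
rewrite -[RHS]card_ord /degree -cardsT.
have inl_inj : injective (inl : 'I_m -> K m n) by move=> i1 i2 [].
rewrite -(card_imset _ inl_inj); apply: eq_card => -[x|x]; rewrite inE /=.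
  by apply/esym/imsetP; exists x; rewrite ?inE.
by apply/esym/negP => /imsetP[].
Qed.

(** A matrix of residues modulo t with interval rows and columns in which
    every residue occurs gives an interval cyclic t-coloring.  The color is the
    residue in 0, ..., t - 1 plus one. *)
Lemma F_K_of_matrix (t : nat) (f : 'I_m -> 'I_n -> nat) :
    0 < t -> maxn m n <= t ->
    (forall i, exists s, forall l, l < n -> exists j, f i j = s + l %[mod t]) ->
    (forall j, exists s, forall l, l < m -> exists i, f i j = s + l %[mod t]) ->
    (forall k, k < t -> exists i j, f i j = k %[mod t]) ->
  F (K m n) t.
Proof.
rewrite geq_max => t_gt0 /andP[le_mt le_nt] rowP colP allP; split=> //.
pose c (e : {set K m n}) :=
  if [pick p | e == Kedge p.1 p.2] is Some p then (f p.1 p.2 %% t).+1 else 0.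
have cE i j : c (Kedge i j) = (f i j %% t).+1.
  rewrite /c; case: pickP => [[i' j'] /eqP/Kedge_inj[-> ->] //|].
  by move=> /(_ (i, j)); rewrite eqxx.
have cP k i j : 1 <= k <= t ->
    c (Kedge i j) = k <-> k = 1 + f i j %[mod t].
  case: k => // k /= lt_kt; rewrite cE.
  split=> [[<-]|/eqP]; first by rewrite -add1n modnDmr.
  by rewrite -[k.+1]add1n eqn_modDl modn_small // => /eqP->.
exists c; split.
- split=> [e /edges_KP[i [j ->]]|e e' v /edges_KP[i [j ->]]].
    by rewrite cE /= ltn_mod.
  move=> /edges_KP[i' [j' ->]]; rewrite !cE; case: v => [x|x].
    rewrite !mem_Kedgel => /eqP-> /eqP-> [eq_f].
    have [s hs] := rowP i'.
    by rewrite (interval_mod_inj le_nt hs eq_f).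
  rewrite !mem_Kedger => /eqP-> /eqP-> [eq_f].
  have [s hs] := colP j'.
  by rewrite (interval_mod_inj (h := f^~ j') le_mt hs eq_f).
- move=> [//|k] lt_kt; have [i [j fk]] := allP k lt_kt.
  by exists (Kedge i j); rewrite ?Kedge_in // cE fk modn_small.
move=> [i|j].
  have [s hs] := rowP i; exists s.+1 => k k_le; rewrite degree_Kl; split.
    case=> _ /edges_KP[i' [j ->]]; rewrite mem_Kedgel => -[/eqP<-].
    move/(cP _ _ _ k_le) => ->.
    have [l lt_ln fl] := interval_mod_surj le_nt hs j.
    by exists l => //; rewrite addSn -add1n; apply/eqP; rewrite eqn_modDl fl.
  case=> l /hs[j fj] kE; exists (Kedge i j); first exact: Kedge_in.
  rewrite mem_Kedgel; split=> //; apply/(cP _ _ _ k_le).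
  by rewrite kE addSn -add1n; apply/eqP; rewrite eqn_modDl fj.
have [s hs] := colP j; exists s.+1 => k k_le; rewrite degree_Kr; split.
  case=> _ /edges_KP[i [j' ->]]; rewrite mem_Kedger => -[/eqP<-].
  move/(cP _ _ _ k_le) => ->.
  have [l lt_lm fl] := interval_mod_surj (h := f^~ j) le_mt hs i.
  by exists l => //; rewrite addSn -add1n; apply/eqP; rewrite eqn_modDl fl.
case=> l /hs[i fi] kE; exists (Kedge i j); first exact: Kedge_in.
rewrite mem_Kedger; split=> //; apply/(cP _ _ _ k_le).
by rewrite kE addSn -add1n; apply/eqP; rewrite eqn_modDl fi.
Qed.

(** The matrix with entries i + j; stars are included. *)
Lemma F_K_le (t : nat) :
  0 < m -> 0 < n -> maxn m n <= t <= m + n - 1 -> F (K m n) t.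
Proof.
move=> m_gt0 n_gt0 /andP[max_le t_le].
apply: (@F_K_of_matrix t (fun i j => i + j)) => // [|i|j|k lt_kt]; first lia.
- by exists i => l lt_ln; exists (Ordinal lt_ln).
- by exists j => l lt_lm; exists (Ordinal lt_lm); rewrite addnC.
have [lt_kn|le_nk] := ltnP k n.
  by exists (Ordinal m_gt0), (Ordinal lt_kn).
have lt_im : k - n.-1 < m by lia.
have lt_jn : n.-1 < n by lia.
by exists (Ordinal lt_im), (Ordinal lt_jn); congr (_ %% _) => /=; lia.
Qed.

(** The matrix with entries i + j, except that n is added to the entries of
    column 0 below the first row. *)
Lemma F_K_add : 1 < m -> 1 < n -> F (K m n) (m + n).
Proof.
move=> m_gt1 n_gt1; have m_gt0 := ltnW m_gt1; have n_gt0 := ltnW n_gt1.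
pose f (i : 'I_m) (j : 'I_n) :=
  if (j == 0 :> nat) && (0 < i) then i + n else i + j.
apply: (@F_K_of_matrix (m + n) f) => [||i|j|k lt_k]; [lia | lia | | | ].
- have [i_gt0|i_eq0] := ltnP 0 i; last first.
    exists 0 => l lt_ln; exists (Ordinal lt_ln).
    by rewrite /f ltnNge i_eq0 andbF /=; congr (_ %% _); lia.
  exists i.+1 => l lt_ln; have [lt_l1n|le_nl1] := ltnP l.+1 n.
    by exists (Ordinal lt_l1n); rewrite /f /= addnS.
  by exists (Ordinal n_gt0); rewrite /f /= i_gt0; congr (_ %% _); lia.
- have [j_gt0|j_eq0] := ltnP 0 j.
    exists j => l lt_lm; exists (Ordinal lt_lm).
    by rewrite /f eqn0Ngt j_gt0 /= addnC.
  have {}j_eq0 : j = 0 :> nat by lia.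
  (* Column 0 is the interval n + 1, ..., n + m, its last residue being that of
     the unchanged entry 0 in row 0. *)
  exists n.+1 => l lt_lm; have [lt_l1m|le_ml1] := ltnP l.+1 m.
    by exists (Ordinal lt_l1m); rewrite /f j_eq0 /=; congr (_ %% _); lia.
  exists (Ordinal m_gt0); rewrite /f j_eq0 /=.
  have -> : n.+1 + l = m + n by lia.
  by rewrite modnn mod0n.
have [lt_kn|le_nk] := ltnP k n.
  by exists (Ordinal m_gt0), (Ordinal lt_kn); rewrite /f andbF.
have [eq_kn|ne_kn] := eqVneq k n.
  have lt_jn : n.-1 < n by lia.
  exists (Ordinal m_gt1), (Ordinal lt_jn); rewrite /f /= andbT.
  by case: eqP => [|_]; [lia | congr (_ %% _); lia].
have lt_im : k - n < m by lia.
exists (Ordinal lt_im), (Ordinal n_gt0); rewrite /f /=.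
by case: ifP => [_|/negbT]; [congr (_ %% _); lia | lia].
Qed.

End CompleteBipartite.

(** The colors at a vertex lying on every edge are distinct and exhaust
    1, ..., t, so such a vertex has degree t. *)
Lemma F_star_degree (G : sgraph) (v : G) (t : nat) :
  (forall e, e \in edges G -> v \in e) -> F G t -> t = degree v.
Proof.
move=> v_e [_ [c [[c_le c_inj] c_all _]]].
have edge_v u : adj v u -> [set v; u] \in edges G.
  by move=> vu; apply/imsetP; exists (v, u); rewrite ?inE.
pose N := [set u : G | adj v u].
rewrite -[LHS](size_iota 1) /degree cardE -(size_map (fun u => c [set v; u])).
apply/perm_size/uniq_perm; first exact: iota_uniq.
  rewrite map_inj_in_uniq ?enum_uniq // => u1 u2.
  rewrite !mem_enum !inE => vu1 vu2 eq_c.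
  have eq_e : [set v; u1] = [set v; u2].
    by apply: (c_inj _ _ v) eq_c; rewrite ?edge_v // !inE eqxx.
  have : u1 \in [set v; u2] by rewrite -eq_e !inE eqxx orbT.
  case/set2P=> // u1v; by move: vu1; rewrite u1v adj_irr.
move=> k; rewrite mem_iota add1n ltnS; apply/idP/mapP => [k_le|[u]].
  have [e eG <-] := c_all k k_le; have := v_e e eG.
  case/imsetP: eG => -[x y]; rewrite inE /= => xy -> /set2P[]->.
    by exists y; rewrite ?mem_enum ?inE.
  by exists x; rewrite ?mem_enum ?inE ?(adj_sym y) // setUC.
by rewrite mem_enum inE => /edge_v/c_le ? ->.
Qed.

Lemma F_K_star (m n t : nat) :
  minn m n = 1 -> F (K m n) t -> t = m + n - 1.
Proof.
move=> min1 Ft; have [m1|n1] : m = 1 \/ n = 1 by lia.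
  move: Ft; rewrite {}m1 => Ft.
  rewrite (@F_star_degree _ (inl ord0 : K 1 n) _ _ Ft) ?degree_Kl; first lia.
  by move=> e /edges_KP[i [j ->]]; rewrite mem_Kedgel (ord1 i).
move: Ft; rewrite {}n1 => Ft.
rewrite (@F_star_degree _ (inr ord0 : K m 1) _ _ Ft) ?degree_Kr; first lia.
by move=> e /edges_KP[i [j ->]]; rewrite mem_Kedger (ord1 j).
Qed.

Theorem theorem29 (m n : nat) (hm : 0 < m) (hn : 0 < n) :
  (minn m n = 1 ->
     is_wc (K m n) (m + n - 1) /\ is_Wc (K m n) (m + n - 1)) /\
  (2 <= minn m n ->
     forall t : nat, maxn m n <= t <= m + n -> F (K m n) t).
Proof.
split=> [min1|min2 t t_le].
  have Fmn : F (K m n) (m + n - 1) by apply: F_K_le => //; lia.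
  by split; split=> // t /(F_K_star min1) ->.
have [->|ne_t] := eqVneq t (m + n); first by apply: F_K_add; lia.
by apply: F_K_le => //; lia.
Qed.
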